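(* Let $M$ be a commutative cancellative monoid with Grothendieck group $G$. Then $M$ is a totally ordered monoid (i.e. $M$ admits a total ordering making it a totally ordered monoid) if and only if $G$ is a torsion-free group.
   Context: All monoids are commutative and written additively. A monoid $M$ is cancellative if $a+c=b+c$ implies $a=b$. The Grothendieck group $G$ of $M$ is the set of equivalence classes $[a,b]$ of pairs $(a,b)\in M\times M$ under $(a,b)\sim(c,d)$ iff there is $m\in M$ with $(a+d)+m=(b+c)+m$, with addition $[a,b]+[c,d]=[a+c,b+d]$. A totally ordered monoid is a monoid $M$ equipped with a total ordering $<$ compatible with its operation: if $a<b$ then $a+c\leqslant b+c$ for all $c\in M$. (If $M$ is cancellative, then $a<b$ yields $a+c<b+c$.) A group is torsion-free if every non-identity element has infinite order. *)

(* Defs.v *)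
From HB Require Import structures.
From mathcomp Require Import all_boot ssralg boolp.

Set Implicit Arguments.
Unset Strict Implicit.
Unset Printing Implicit Defensive.

Import GRing.Theory.

Local Open Scope ring_scope.
Local Open Scope quotient_scope.

Definition cancellative (M : nmodType) : Prop :=
  forall a b c : M, a + c = b + c -> a = b.

(* The relation is stated with the non-strict order; the strict order is
   [le a b && (a != b)]. *)
Definition total_order (T : eqType) (le : rel T) : Prop :=
  [/\ reflexive le, antisymmetric le, transitive le & total le].

Definition add_compatible (M : nmodType) (le : rel M) : Prop :=
  forall a b : M, le a b && (a != b) -> forall c : M, le (a + c) (b + c).

Definition totally_orderable (M : nmodType) : Prop :=
  exists le : rel M, total_order le /\ add_compatible le.

Definition torsion_free (G : zmodType) : Prop :=
  forall x : G, x != 0 -> forall n : nat, (0 < n)%N -> x *+ n != 0.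

(* [asbool] is needed because quotients are taken by boolean relations. *)
Definition groth_rel (M : nmodType) : rel (M * M) :=
  fun x y => `[< exists m : M, (x.1 + y.2) + m = (x.2 + y.1) + m >].

Lemma groth_rel_refl (M : nmodType) : reflexive (@groth_rel M).
Proof. by move=> x; apply/asboolP; exists 0; rewrite (addrC x.1). Qed.

Lemma groth_rel_sym (M : nmodType) : symmetric (@groth_rel M).
Proof.
have sub (x y : M * M) : groth_rel x y -> groth_rel y x.
  move=> /asboolP[m e]; apply/asboolP; exists m.
  by rewrite (addrC y.1) (addrC y.2) e.
by move=> x y; apply/idP/idP; apply: sub.
Qed.

Lemma groth_rel_trans (M : nmodType) : transitive (@groth_rel M).
Proof.
move=> y x z /asboolP[m e] /asboolP[n f]; apply/asboolP.
exists (y.1 + y.2 + (m + n)).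
rewrite [LHS](AC (2*(2*2)) ((1*4*5)*(3*2*6))) /= e f.
by rewrite [LHS](AC (3*3) ((1*5)*((2*4)*(3*6)))).
Qed.

Canonical groth_equiv (M : nmodType) :=
  EquivRel (@groth_rel M) (@groth_rel_refl M) (@groth_rel_sym M)
    (@groth_rel_trans M).

Definition grothendieck (M : nmodType) : Type := {eq_quot @groth_rel M}.

HB.instance Definition _ (M : nmodType) := Choice.on (grothendieck M).

Definition groth_class (M : nmodType) (a b : M) : grothendieck M :=
  \pi_{eq_quot @groth_rel M} (a, b).

Definition groth_repr (M : nmodType) (x : grothendieck M) : M * M :=
  repr (x : {eq_quot @groth_rel M}).

Lemma groth_reprK (M : nmodType) (x : grothendieck M) :
  groth_class (groth_repr x).1 (groth_repr x).2 = x.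
Proof. by rewrite /groth_class -surjective_pairing; apply: reprK. Qed.

Lemma groth_classP (M : nmodType) (a b c d : M) :
  groth_class a b = groth_class c d <->
  exists m : M, (a + d) + m = (b + c) + m.
Proof.
split=> [/eqmodP/asboolP //|e].
by apply/eqmodP/asboolP.
Qed.

Definition groth_zero (M : nmodType) : grothendieck M := groth_class 0 0.

Definition groth_opp (M : nmodType) (x : grothendieck M) : grothendieck M :=
  groth_class (groth_repr x).2 (groth_repr x).1.

Definition groth_add (M : nmodType) (x y : grothendieck M) : grothendieck M :=
  groth_class ((groth_repr x).1 + (groth_repr y).1)
              ((groth_repr x).2 + (groth_repr y).2).

Lemma groth_addE (M : nmodType) (a b c d : M) :
  groth_add (groth_class a b) (groth_class c d) = groth_class (a + c) (b + d).
Proof.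
have /groth_classP[m e] := groth_reprK (groth_class a b).
have /groth_classP[n f] := groth_reprK (groth_class c d).
rewrite /groth_add; apply/groth_classP; exists (m + n).
by rewrite (addrACA _ _ b) (addrACA (_ + b)) e f addrACA (addrACA _ a).
Qed.

Lemma groth_oppE (M : nmodType) (a b : M) :
  groth_opp (groth_class a b) = groth_class b a.
Proof.
have /groth_classP[m e] := groth_reprK (groth_class a b).
by rewrite /groth_opp; apply/groth_classP; exists m; rewrite e.
Qed.

Lemma groth_addA (M : nmodType) : associative (@groth_add M).
Proof.
move=> x y z; rewrite -(groth_reprK x) -(groth_reprK y) -(groth_reprK z).
by rewrite !groth_addE !addrA.
Qed.

Lemma groth_addC (M : nmodType) : commutative (@groth_add M).
Proof.
by move=> x y; rewrite /groth_add; congr groth_class; rewrite addrC.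
Qed.

Lemma groth_add0 (M : nmodType) : left_id (@groth_zero M) (@groth_add M).
Proof. by move=> x; rewrite -(groth_reprK x) groth_addE !add0r. Qed.

Lemma groth_addN (M : nmodType) :
  left_inverse (@groth_zero M) (@groth_opp M) (@groth_add M).
Proof.
move=> x; rewrite -(groth_reprK x) groth_oppE groth_addE.
by apply/groth_classP; exists 0; rewrite !addr0 addrC.
Qed.

HB.instance Definition _ (M : nmodType) :=
  GRing.isZmodule.Build (grothendieck M)
    (@groth_addA M) (@groth_addC M) (@groth_add0 M) (@groth_addN M).

(* Main.v *)
(** A strict positive cone of an abelian group is a set closed under addition
    that avoids 0.  Zorn's lemma gives a maximal one, P.  If neither x nor -x
    were in P for some x <> 0, adjoining x would produce 0, so that -nx lies in
    P for some n > 0, and adjoining -x gives mx in P for some m > 0; then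
    0 = m(-nx) + n(mx) lies in P.  Hence P orders a torsion-free group totally,
    and a cancellative monoid inherits the order of its Grothendieck group.
    Conversely a < b implies na < nb for n > 0, so that n[a, b] <> 0. *)
Require Import Defs.
From mathcomp Require Import all_boot ssralg.
From mathcomp Require Import boolp classical_sets.

Set Implicit Arguments.
Unset Strict Implicit.
Unset Printing Implicit Defensive.

Import GRing.Theory.

Local Open Scope ring_scope.

Section Cones.
Variable G : zmodType.
Implicit Types (P : set G) (x y : G).

Definition strict_cone P := ~ P 0 /\ forall x y, P x -> P y -> P (x + y).

Lemma strict_cone_mulrn P x n : strict_cone P -> P x -> P (x *+ n.+1).
Proof.
move=> [_ PD] Px; elim: n => [|n IHn]; first by rewrite mulr1n.
by rewrite mulrS; apply: PD.
Qed.

(** The cone generated by [P] and [x]. A multiple of [x] alone needs [p = 0], which a strict cone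
    lacks; [0 < n] then keeps out the empty sum. *)
Definition adjoin_cone P x : set G :=
  [set y | exists n p, y = p + x *+ n /\ (P p \/ p = 0 /\ (0 < n)%N)]%classic.

Lemma sub_adjoin_cone P x : (P `<=` adjoin_cone P x)%classic.
Proof. by move=> p Pp; exists 0%N, p; split; [rewrite addr0 | left]. Qed.

Lemma mem_adjoin_cone P x : adjoin_cone P x x.
Proof. by exists 1%N, 0; split; [rewrite add0r | right]. Qed.

Lemma adjoin_coneD P x y z : strict_cone P ->
  adjoin_cone P x y -> adjoin_cone P x z -> adjoin_cone P x (y + z).
Proof.
move=> [_ PD] [n [p [-> Hp]]] [m [q [-> Hq]]].
exists (n + m)%N, (p + q); split; first by rewrite mulrnDr addrACA.
case: Hp Hq => [Pp|[-> n0]] [Pq|[-> m0]].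
- by left; apply: PD.
- by left; rewrite addr0.
- by left; rewrite add0r.
- by right; rewrite addr0 addn_gt0 n0.
Qed.

Lemma maximal_cone_adjoin P x : torsion_free G -> strict_cone P ->
    (forall Q, (P `<` Q)%classic -> ~ strict_cone Q) ->
  x != 0 -> ~ P x -> exists n, P (- (x *+ n.+1)).
Proof.
move=> tfG coneP maxP x0 NPx.
have PQ : (P `<` adjoin_cone P x)%classic.
  split; first exact: sub_adjoin_cone.
  by move/(_ x (@mem_adjoin_cone P x)).
have [n [p [e Hp]]] : adjoin_cone P x 0.
  apply: contrapT => NQ0; apply: (maxP _ PQ); split=> // y z.
  exact: adjoin_coneD.
have {}e : p = - (x *+ n) by apply/eqP; rewrite -addr_eq0 -e.
(* With [p = 0] the element [x] would be torsion, and with [n = 0] the cone [P] would contain 0. *)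
case: Hp => [Pp|[p0 n0]]; last first.
  by move/eqP: e; rewrite p0 eq_sym oppr_eq0 (negPf (tfG x x0 n n0)).
case: n e => [|n] e; last by exists n; rewrite -e.
by case: coneP; rewrite e oppr0 in Pp.
Qed.

Lemma exists_total_cone : torsion_free G ->
  exists2 P, strict_cone P & forall x, x != 0 -> P x \/ P (- x).
Proof.
move=> tfG; have [F Fcone Ftot|P [coneP maxP]] := @Zorn_bigcup G strict_cone.
  (* Two members of a chain are nested, so both summands lie in the larger one. The empty chain has
     the empty cone as its union. *)
  split=> [[A FA A0]|x y [A FA Ax] [B FB By]]; first by case: (Fcone A FA).
  have [AB|BA] := Ftot _ _ FA FB.
    by exists B => //; apply: (Fcone B FB).2 => //; apply: AB.
  by exists A => //; apply: (Fcone A FA).2 => //; apply: BA.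
exists P => // x x0; apply: contrapT => /not_orP[NPx NPNx].
have [n Pn] := maximal_cone_adjoin tfG coneP maxP x0 NPx.
have Nx0 : - x != 0 by rewrite oppr_eq0.
have [m] := maximal_cone_adjoin tfG coneP maxP Nx0 NPNx.
rewrite mulNrn opprK => Pm; apply: coneP.1.
rewrite -(addNr (x *+ n.+1 *+ m.+1)) -mulNrn; apply: coneP.2.
  exact: strict_cone_mulrn.
by rewrite mulrnAC; apply: strict_cone_mulrn.
Qed.

Lemma torsion_free_totally_orderable : torsion_free G -> totally_orderable G.
Proof.
move=> /exists_total_cone[P [NP0 PD] Ptot].
exists (fun x y => `[< x = y \/ P (y - x) >]); split; first split.
- by move=> x; apply/asboolP; left.
(* If both differences were in [P], so would be their sum, 0. *)
- move=> x y /andP[/asboolP[//|Pyx] /asboolP[//|Pxy]].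
  by case: NP0; rewrite -(subrr y) -(subrKA x); apply: PD.
- move=> y x z /asboolP[->//|Pyx] /asboolP[<-|Pzy]; apply/asboolP; right=> //.
  by rewrite -(subrKA y); apply: PD.
- move=> x y; have [->|xy] := eqVneq x y.
    by apply/orP; left; apply/asboolP; left.
  have /Ptot[Pxy|] : x - y != 0 by rewrite subr_eq0.
    by apply/orP; right; apply/asboolP; right.
  by rewrite opprB => Pyx; apply/orP; left; apply/asboolP; right.
- move=> x y /andP[/asboolP[->|Pyx] _] z; apply/asboolP; first by left.
  by right; rewrite opprD addrACA subrr addr0.
Qed.

End Cones.

(** The order is pulled back along [f]. Injectivity gives antisymmetry and keeps strict inequalities
    strict, as compatibility in [N] requires. *)
Lemma totally_orderable_inj (M N : nmodType) (f : M -> N) :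
    {morph f : x y / x + y} -> injective f ->
  totally_orderable N -> totally_orderable M.
Proof.
move=> fD fI [le [[leR leA leT leO] leD]].
exists (fun x y => le (f x) (f y)); split; first split.
- by move=> x; apply: leR.
- by move=> x y /leA/fI.
- by move=> y x z; apply: leT.
- by move=> x y; apply: leO.
- by move=> x y xy z; rewrite !fD; apply: leD; rewrite (inj_eq fI).
Qed.

Lemma add_compatible_mulrn (M : nmodType) (le : rel M) (a b : M) (n : nat) :
    cancellative M -> total_order le -> add_compatible le ->
  le a b && (a != b) -> le (a *+ n.+1) (b *+ n.+1) && (a *+ n.+1 != b *+ n.+1).
Proof.
move=> hM [leR leA leT _] leD ab.
(* Cancellation makes translation strictly monotone. *)
have ltD x y z : le x y && (x != y) -> le (x + z) (y + z) && (x + z != y + z).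
  move=> xy; rewrite leD //=; apply: contraTneq xy => /hM ->.
  by rewrite eqxx andbF.
have ltT x y z : le x y && (x != y) -> le y z && (y != z) ->
    le x z && (x != z).
  move=> /andP[xy nxy] /andP[yz _]; rewrite (leT _ _ _ xy yz) /=.
  by apply: contraNneq nxy => xz; apply/eqP/leA; rewrite xy xz yz.
elim: n => [|n IHn]; first by rewrite !mulr1n.
(* The intermediate term replaces one summand [a] by [b]; the induction hypothesis replaces the
   others. *)
rewrite (mulrS a n.+1) (mulrS b n.+1) (ltT _ (b + a *+ n.+1)) ?ltD //.
by rewrite !(addrC b) ltD.
Qed.

(** By totality, distinct elements are strictly comparable, and multiplication by [n.+1] preserves
    this. *)
Lemma totally_orderable_mulIrn (M : nmodType) (n : nat) :
    cancellative M -> totally_orderable M ->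
  injective (fun a : M => a *+ n.+1).
Proof.
move=> hM [le [leP leD]] a b /= e; apply/eqP; apply: contraT => ab.
have [_ _ _ leO] := leP.
have [le_ab|le_ba] := orP (leO a b).
  have := @add_compatible_mulrn M le a b n hM leP leD.
  by rewrite e eqxx le_ab ab andbF => /(_ isT).
have := @add_compatible_mulrn M le b a n hM leP leD.
by rewrite e eqxx le_ba eq_sym ab andbF => /(_ isT).
Qed.

Lemma groth_class_mulrn (M : nmodType) (a b : M) (n : nat) :
  groth_class a b *+ n = groth_class (a *+ n) (b *+ n).
Proof.
by elim: n => [//|n IHn]; rewrite !mulrS IHn; apply: groth_addE.
Qed.

Lemma groth_class_eq0 (M : nmodType) (a b : M) : cancellative M ->
  groth_class a b = 0 <-> a = b.
Proof.
move=> hM; rewrite (_ : 0 = groth_class 0 0) // groth_classP.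
by split=> [[m]|->]; [rewrite !addr0 => /hM | exists 0].
Qed.

Theorem theorem3p3 (M : nmodType) (hM : cancellative M) :
  totally_orderable M <-> torsion_free (grothendieck M).
Proof.
split=> [ordM x x0 [//|n] _|/torsion_free_totally_orderable].
  (* For [x = [a, b]], a vanishing multiple means that [a] and [b] have equal multiples, hence
     [a = b] and [x = 0]. *)
  apply: contra_neq x0; rewrite -(groth_reprK x) groth_class_mulrn.
  move=> /(groth_class_eq0 _ _ hM) e; apply/(groth_class_eq0 _ _ hM).
  exact: (totally_orderable_mulIrn hM ordM e).
(* The canonical map to the Grothendieck group is injective by cancellation. *)
apply: (@totally_orderable_inj _ _ (fun a => groth_class a 0)).
  by move=> a b; rewrite -{1}[0](addr0 0); apply/esym/groth_addE.
by move=> a b /groth_classP[m /hM]; rewrite addr0 add0r.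
Qed.
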